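(* Let $k\ge1$ and let $\psi(\cdot;\theta)$ be the network defined, for $z\in\mathbb{R}^n$, by $x_0=0$, $x_{i+1}=g_i\bigl(W_i^{x}x_i+W_i^{z}z+b_i\bigr)$ for $i=0,\dots,k-1$, and $\psi(z;\theta)=x_k\in\mathbb{R}$, where $W_0^x=0$, $W_i^x\ge0$ elementwise for $i=1,\dots,k-1$, $g_i$ is the elementwise ReLU for $i=0,\dots,k-2$, and $g_{k-1}$ is the identity map. Then for every $z\in\mathbb{R}^n$, $\psi(z;\theta)$ equals the optimal value of the linear program $$\begin{aligned}\min_{x_1,\dots,x_k}\;& x_k\\ \text{s.t. }\;& x_{i+1}\ge W_i^x x_i+W_i^z z+b_i,\quad i=0,\dots,k-1,\\ & x_i\ge 0,\quad i=1,\dots,k-1,\end{aligned}$$ with $x_0=0$ (inequalities between vectors being elementwise). Consequently, $\psi(z;\theta)$ is convex, continuous, and piecewise linear in $z$.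
   Context: $x_i$ is the (real vector) output of layer $i$; $W_i^x,W_i^z$ are real matrices and $b_i$ real vectors of compatible dimensions; $\theta$ collects all of these parameters. The ReLU is $\operatorname{ReLU}(s)=\max(0,s)$, applied elementwise. ''Piecewise linear'' means piecewise affine: $\mathbb{R}^n$ is a finite union of polyhedra on each of which the function is affine. *)

(* Defs.v *)
From HB Require Import structures.
From mathcomp Require Import all_boot all_order all_algebra.
From mathcomp Require Import all_classical all_reals all_analysis.

Set Implicit Arguments.
Unset Strict Implicit.
Unset Printing Implicit Defensive.

Import Order.TTheory GRing.Theory Num.Theory.
Import numFieldNormedType.Exports.

Local Open Scope classical_set_scope.
Local Open Scope ring_scope.

(* Real numbers are an arbitrary [R : realType], and R^m is ['cV[R]_m]. *)

Definition mx_le (R : realType) (m p : nat) (A B : 'M[R]_(m, p)) : Prop :=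
  forall i j, A i j <= B i j.

Definition relu (R : realType) (s : R) : R := Num.max 0 s.

(* [d i] is the dimension of the output of layer [i]. The families are indexed
   by all of [nat] only to avoid bounded-index casts: a network with [k] layers
   uses the entries of index [i < k] and ignores the others. *)
Record params (R : realType) (n : nat) (d : nat -> nat) := Params {
  Wx : forall i : nat, 'M[R]_(d i.+1, d i);
  Wz : forall i : nat, 'M[R]_(d i.+1, n);
  bias : forall i : nat, 'cV[R]_(d i.+1)
}.

Section Network.
Variables (R : realType) (n : nat) (d : nat -> nat) (k : nat).
Variable theta : params R n d.

Definition preact (i : nat) (x : 'cV[R]_(d i)) (z : 'cV[R]_n) :
    'cV[R]_(d i.+1) :=
  Wx theta i *m x + Wz theta i *m z + bias theta i.

Definition activation (i m : nat) (v : 'cV[R]_m) : 'cV[R]_m :=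
  if i == k.-1 then v else map_mx (@relu R) v.

Fixpoint layer (z : 'cV[R]_n) (i : nat) : 'cV[R]_(d i) :=
  match i with
  | 0 => 0
  | j.+1 => activation j (preact (layer z j) z)
  end.

(* The real number underlying a vector of R^(d k) when [d k = 1]. *)
Definition scalar_of (dk1 : d k = 1%N) (v : 'cV[R]_(d k)) : R :=
  v (cast_ord (esym dk1) ord0) ord0.

Definition psi (dk1 : d k = 1%N) (z : 'cV[R]_n) : R :=
  scalar_of dk1 (layer z k).

(* The decision variables are the blocks [x 1, ..., x k]; [x 0] is fixed to 0,
   and blocks of index greater than [k] occur neither in the constraints nor
   in the objective. *)
Definition lp_feasible (z : 'cV[R]_n) (x : forall i : nat, 'cV[R]_(d i)) :
    Prop :=
  [/\ x 0%N = 0,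
      forall i : nat, (i < k)%N -> mx_le (preact (x i) z) (x i.+1) &
      forall i : nat, (0 < i < k)%N -> mx_le 0 (x i)].

Definition lp_objective (dk1 : d k = 1%N) (x : forall i : nat, 'cV[R]_(d i)) :
    R :=
  scalar_of dk1 (x k).

End Network.

(* [v] is the optimal value of "minimize [obj] over [feasible]"; in particular
   the problem is feasible, bounded below, and its minimum is attained. *)
Definition is_min_value (R : realType) (X : Type) (feasible : X -> Prop)
    (obj : X -> R) (v : R) : Prop :=
  (exists2 x, feasible x & obj x = v) /\
  (forall x, feasible x -> v <= obj x).

Definition polyhedron (R : realType) (n : nat) (P : set 'cV[R]_n) : Prop :=
  exists (m : nat) (A : 'M[R]_(m, n)) (c : 'cV[R]_m),
    P = [set z | mx_le (A *m z) c].

Definition affine_on (R : realType) (n : nat) (P : set 'cV[R]_n)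
    (f : 'cV[R]_n -> R) : Prop :=
  exists (a : 'rV[R]_n) (c : R),
    forall z, P z -> f z = (a *m z) ord0 ord0 + c.

Definition piecewise_linear (R : realType) (n : nat) (f : 'cV[R]_n -> R) :
    Prop :=
  exists (N : nat) (P : 'I_N -> set 'cV[R]_n),
    [/\ forall i, polyhedron (P i),
        \bigcup_(i in [set: 'I_N]) P i = [set: 'cV[R]_n] &
        forall i, affine_on (P i) f].

(* Main.v *)
(* Since W^x >= 0, each preactivation is monotone in x_i, so by induction the
   layers are the componentwise smallest feasible point of the linear program;
   this gives the optimal value. The feasible set is jointly convex in (z, x),
   hence a convex combination of the layers at z and w is feasible at the
   combined input, which gives convexity of the optimal value. Continuity and
   piecewise linearity are inherited from layer to layer. *)
Require Import Defs.
From HB Require Import structures.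
From mathcomp Require Import all_boot all_order all_algebra.
From mathcomp Require Import all_classical all_reals all_analysis.

Import Order.TTheory GRing.Theory Num.Theory.
Import numFieldNormedType.Exports.

Local Open Scope classical_set_scope.
Local Open Scope ring_scope.

Section MatrixOrder.
Context {R : realType}.

Lemma mx_le_refl m p (A : 'M[R]_(m, p)) : mx_le A A.
Proof. by []. Qed.

Lemma mx_le_trans m p (B A C : 'M[R]_(m, p)) :
  mx_le A B -> mx_le B C -> mx_le A C.
Proof. by move=> AB BC i j; exact: le_trans (AB i j) (BC i j). Qed.

Lemma mx_leD m p (A B C D : 'M[R]_(m, p)) :
  mx_le A B -> mx_le C D -> mx_le (A + C) (B + D).
Proof. by move=> AB CD i j; rewrite !mxE lerD. Qed.

Lemma mx_leZ m p (t : R) (A B : 'M[R]_(m, p)) :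
  0 <= t -> mx_le A B -> mx_le (t *: A) (t *: B).
Proof. by move=> t0 AB i j; rewrite !mxE ler_wpM2l. Qed.

Lemma mx_leM m p q (W : 'M[R]_(m, p)) (A B : 'M[R]_(p, q)) :
  mx_le 0 W -> mx_le A B -> mx_le (W *m A) (W *m B).
Proof.
move=> W0 AB i j; rewrite !mxE; apply: ler_sum => l _.
by apply: ler_wpM2l; [have := W0 i l; rewrite mxE | exact: AB].
Qed.

End MatrixOrder.

Section LinearProgram.
Context {R : realType} {n : nat} {d : nat -> nat}.
Variables (k : nat) (theta : params R n d).

Lemma preact_conv i (t s : R) (x y : 'cV[R]_(d i)) (z w : 'cV[R]_n) :
  t + s = 1 ->
  preact theta (t *: x + s *: y) (t *: z + s *: w) =
  t *: preact theta x z + s *: preact theta y w.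
Proof.
move=> ts1; rewrite /preact !scalerDr.
(* The weights sum to 1, so the bias splits like the linear terms. *)
have {1}-> : bias theta i = t *: bias theta i + s *: bias theta i.
  by rewrite -scalerDl ts1 scale1r.
by rewrite !mulmxDr -!scalemxAr [RHS]addrACA; congr (_ + _); exact: addrACA.
Qed.

Lemma activation_ge i m (v : 'cV[R]_m) : mx_le v (activation k i v).
Proof.
rewrite /activation; case: eqP => _ a b //.
by rewrite mxE /relu le_max lexx orbT.
Qed.

Lemma activation_ge0 i m (v : 'cV[R]_m) :
  i != k.-1 -> mx_le 0 (activation k i v).
Proof.
rewrite /activation => /negbTE -> a b.
by rewrite !mxE /relu le_max lexx.
Qed.

Lemma layer_feasible z : lp_feasible k theta z (layer k theta z).
Proof.
split=> // [i _|[|i] // /andP[_ ik]]; first exact: activation_ge.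
(* Block [i.+1] comes from activation [i], and [i.+1 < k] rules out the identity, which has index
   [k.-1]. *)
by apply: activation_ge0; rewrite neq_ltn -ltnS prednK ?ik // (leq_trans _ ik).
Qed.

Hypothesis Wx_ge0 : forall i : nat, (1 <= i <= k.-1)%N -> mx_le 0 (Wx theta i).

Lemma layer_min z x : lp_feasible k theta z x ->
  forall i, (i <= k)%N -> mx_le (layer k theta z i) (x i).
Proof.
case=> x0 xS x_ge0; elim=> [_|i IH ik]; first by rewrite x0.
have pre_le : mx_le (preact theta (layer k theta z i) z) (x i.+1).
  apply: mx_le_trans (xS i ik).
  apply: mx_leD; last exact: mx_le_refl.
  apply: mx_leD; last exact: mx_le_refl.
  (* [Wx_ge0] starts at index 1; at index 0 both inputs are 0, so the two products agree. *)
  case: i IH ik => [|i] IH ik; first by rewrite x0; exact: mx_le_refl.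
  apply: mx_leM; last exact/IH/ltnW.
  by apply: Wx_ge0; rewrite /= -ltnS prednK ?ik // (leq_trans _ ik).
rewrite /= /activation; case: eqP => [//|/eqP ik1 a b].
rewrite mxE /relu ge_max pre_le andbT.
(* A ReLU step has [i.+1 < k], so the sign constraint on [x i.+1] supplies the other half of the
   bound on the maximum. *)
have : mx_le 0 (x i.+1).
  apply: x_ge0; rewrite /= ltn_neqAle ik andbT.
  by apply: contra ik1 => /eqP <-.
by move=> /(_ a b); rewrite mxE.
Qed.

Lemma psi_lp_value (dk1 : d k = 1%N) z :
  is_min_value (lp_feasible k theta z) (@lp_objective R d k dk1)
    (psi theta dk1 z).
Proof.
split; first by exists (layer k theta z) => //; exact: layer_feasible.
by move=> x /layer_min /(_ k (leqnn k)) le_x; exact: le_x.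
Qed.

Lemma lp_feasible_conv (t s : R) z w x y :
  0 <= t -> 0 <= s -> t + s = 1 ->
  lp_feasible k theta z x -> lp_feasible k theta w y ->
  lp_feasible k theta (t *: z + s *: w) (fun i => t *: x i + s *: y i).
Proof.
move=> t0 s0 ts1 [x0 xS xge0] [y0 yS yge0]; split=> [|i ik|i ik].
- by rewrite x0 y0 !scaler0 addr0.
- by rewrite preact_conv //; apply: mx_leD; apply: mx_leZ; auto.
- have -> : 0 = t *: 0 + s *: 0 :> 'cV[R]_(d i) by rewrite !scaler0 addr0.
  by apply: mx_leD; apply: mx_leZ; auto.
Qed.

Lemma psi_convex (dk1 : d k = 1%N) :
  convex_function [set: 'cV[R]_n] (psi theta dk1).
Proof.
move=> t z w _ _.
(* The optimal value at the combined input is bounded by the objective at the combined layers, which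
   is the same combination of the two values of [psi]. *)
have [_ /(_ (fun i => t%:num *: layer k theta z i +
                      (1 - t%:num) *: layer k theta w i))] :=
  psi_lp_value dk1 (t%:num *: z + (1 - t%:num) *: w).
rewrite /lp_objective /scalar_of !mxE; apply.
apply: lp_feasible_conv; [| |by rewrite addrC subrK|exact: layer_feasible..].
- by rewrite ge0.
- by rewrite subr_ge0 le1.
Qed.

End LinearProgram.

Section Continuity.
Context {R : realType} {n : nat}.

Lemma mulmx_entry_continuous m p (W : 'M[R]_(m, p)) (f : 'cV[R]_n -> 'cV[R]_p) :
  (forall i j, continuous (fun z => f z i j)) ->
  forall i j, continuous (fun z => (W *m f z) i j).
Proof.
move=> fc i j.
under eq_fun do rewrite mxE.
apply: (@continuous_big _ _ +%R); first exact: add_continuous.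
by move=> l _ z; apply: continuousM; [exact: cst_continuous | exact: fc].
Qed.

(** Working entry by entry leaves only sums, products and maxima of real-valued functions. *)
Lemma layer_entry_continuous d k (theta : params R n d) l i j :
  continuous (fun z => layer k theta z l i j).
Proof.
elim: l i j => [|l IH] i j; first exact: cst_continuous.
have pre_cont a b :
    continuous (fun z => preact theta (layer k theta z l) z a b).
  under eq_fun do rewrite mxE [X in X + _]mxE.
  move=> z; have nbz : Filter (nbhs z) by exact: nbhs_filter.
  apply: (@cvgD _ R^o); last exact: cvg_cst.
  apply: (@cvgD _ R^o).
    exact: mulmx_entry_continuous.
  by apply: (mulmx_entry_continuous _ _ _ id) => ? ?; exact: coord_continuous.
rewrite /= /activation; case: eqP => // _.
under eq_fun do rewrite mxE /relu.
move=> z; apply: continuous_max; [exact: cst_continuous | exact: pre_cont].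
Qed.

End Continuity.

Section PiecewiseAffine.
Context {R : realType} {n : nat}.

(** The two systems of inequalities are stacked into one. *)
Lemma polyhedronI (P Q : set 'cV[R]_n) :
  polyhedron P -> polyhedron Q -> polyhedron (P `&` Q).
Proof.
move=> [m [A [a ->]]] [p [B [b ->]]].
exists (m + p)%N, (col_mx A B), (col_mx a b).
apply/seteqP; split=> z /=; rewrite mul_col_mx.
  move=> [leA leB] i j; rewrite -(splitK i); case: (fintype.split i) => l /=.
    by rewrite !col_mxEu.
  by rewrite !col_mxEd.
move=> leAB; split=> i j.
  by have := leAB (lshift p i) j; rewrite !col_mxEu.
by have := leAB (rshift m i) j; rewrite !col_mxEd.
Qed.

Lemma polyhedronT : polyhedron [set: 'cV[R]_n].
Proof.
by exists 0%N, 0, 0; apply/seteqP; split=> z //= _ [].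
Qed.

(** Vector-valued form of [piecewise_linear], suited to induction on layers. An arbitrary finite
    index type lets pieces be refined by a product of index types. *)
Definition piecewise_affine m (f : 'cV[R]_n -> 'cV[R]_m) : Prop :=
  exists (I : finType) (P : I -> set 'cV[R]_n)
         (A : I -> 'M[R]_(m, n)) (c : I -> 'cV[R]_m),
    [/\ forall i, polyhedron (P i),
        forall z, exists i, P i z &
        forall i z, P i z -> f z = A i *m z + c i].

Lemma piecewise_affine_preact d (theta : params R n d) i
    (f : 'cV[R]_n -> 'cV[R]_(d i)) :
  piecewise_affine _ f -> piecewise_affine _ (fun z => preact theta (f z) z).
Proof.
move=> [I [P [A [c [polyP coverP fE]]]]].
exists I, P, (fun j => Wx theta i *m A j + Wz theta i),
  (fun j => Wx theta i *m c j + bias theta i); split=> // j z /fE {}fE.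
rewrite /preact fE mulmxDr mulmxDl mulmxA addrACA -!addrA.
by rewrite (addrCA (_ *m c j)).
Qed.

(* Each piece is split according to the set [s] of coordinates on which [f] is
   required to be nonnegative, [f] being nonpositive on the others. *)
Lemma piecewise_affine_relu m (f : 'cV[R]_n -> 'cV[R]_m) :
  piecewise_affine _ f ->
  piecewise_affine _ (fun z => map_mx (@relu R) (f z)).
Proof.
move=> [I [P [A [c [polyP coverP fE]]]]].
(* [S s] flips the signs of the coordinates in [s], so that the sign pattern reads
   [S s *m f z <= 0]; [E s] keeps the coordinates in [s] and kills the others, which is how ReLU
   acts under that pattern. In [Q] the constant term is moved to the right to match [polyhedron]. *)
pose S (s : {set 'I_m}) : 'M[R]_m := diag_mx (\row_j (-1) ^+ (j \in s)).
pose E (s : {set 'I_m}) : 'M[R]_m := diag_mx (\row_j (j \in s)%:R).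
pose Q (s : {set 'I_m}) i : set 'cV[R]_n :=
  [set z | mx_le (S s *m A i *m z) (- (S s *m c i))].
have QE s i z : P i z ->
    Q s i z <-> forall j, (-1) ^+ (j \in s) * f z j ord0 <= 0.
  move=> /fE {}fE.
  have SE j b : (S s *m A i *m z) j b - (- (S s *m c i)) j b =
                (-1) ^+ (j \in s) * f z j ord0.
    rewrite -!mulmxA /S !mul_diag_mx !mxE opprK.
    by rewrite fE mxE mulrDr (ord1 b) mxE.
  by split=> [le j|le j b]; [rewrite -(SE j ord0) subr_le0; exact: le
                            | rewrite -subr_le0 SE].
exists (I * {set 'I_m})%type, (fun u => P u.1 `&` Q u.2 u.1),
  (fun u => E u.2 *m A u.1), (fun u => E u.2 *m c u.1); split.
- move=> [i s] /=; apply: polyhedronI => //.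
  by exists m, (S s *m A i), (- (S s *m c i)).
- move=> z; have [i Pi] := coverP z.
  (* Zero coordinates fit either sign; they are put in [s]. *)
  exists (i, [set j | 0 <= f z j ord0]%SET); split=> //=.
  apply/QE => // j; rewrite inE; case: (leP 0 (f z j ord0)) => [f0|/ltW f0].
    by rewrite expr1 mulN1r oppr_le0.
  by rewrite expr0 mul1r.
- move=> [i s] z [/= Pi /(QE _ _ _ Pi) sgn].
  rewrite -mulmxA -mulmxDr -fE //; apply/matrixP => j b.
  rewrite mul_diag_mx !mxE (ord1 b) /relu; have := sgn j; case: (j \in s).
    by rewrite expr1 mulN1r oppr_le0 mul1r => /max_r.
  by rewrite expr0 mul1r mul0r => /max_l.
Qed.

Lemma piecewise_affine_layer d k (theta : params R n d) l :
  piecewise_affine _ (fun z => layer k theta z l).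
Proof.
elim: l => [|l IH].
  exists unit, (fun=> setT), (fun=> 0), (fun=> 0); split.
  - by move=> _; exact: polyhedronT.
  - by move=> z; exists tt.
  - by move=> ? z _; rewrite mul0mx addr0.
rewrite /= /activation; case: eqP => _; last apply: piecewise_affine_relu.
  exact: piecewise_affine_preact.
exact: piecewise_affine_preact.
Qed.

(** Enumerating the index type gives the ordinals required by [piecewise_linear]; row [j] of each
    matrix is the linear part. *)
Lemma piecewise_linear_entry m (f : 'cV[R]_n -> 'cV[R]_m) j :
  piecewise_affine _ f -> piecewise_linear (fun z => f z j ord0).
Proof.
move=> [I [P [A [c [polyP coverP fE]]]]].
exists #|I|, (fun a => P (enum_val a)); split=> //.
  apply/seteqP; split=> // z _; have [i Pi] := coverP z.
  by exists (enum_rank i) => //; rewrite enum_rankK.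
move=> a; exists (row j (A (enum_val a))), (c (enum_val a) j ord0) => z /fE ->.
by rewrite -row_mul !mxE.
Qed.

End PiecewiseAffine.

Theorem proposition2 (R : realType) (n k : nat) (d : nat -> nat)
    (theta : params R n d)
    (k_ge1 : (1 <= k)%N) (dk1 : d k = 1%N)
    (Wx0 : Wx theta 0 = 0)
    (Wx_ge0 : forall i : nat, (1 <= i <= k.-1)%N -> mx_le 0 (Wx theta i)) :
  (forall z : 'cV[R]_n,
     is_min_value (lp_feasible k theta z) (@lp_objective R d k dk1)
       (psi theta dk1 z)) /\
  [/\ convex_function [set: 'cV[R]_n] (psi theta dk1),
      continuous (psi theta dk1) &
      piecewise_linear (psi theta dk1)].
Proof.
split=> [z|]; first exact: psi_lp_value.
split; first exact: psi_convex.
(* [psi] unfolds to a single entry of layer [k], so the entrywise results apply. *)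
- exact: layer_entry_continuous.
- by apply: piecewise_linear_entry; exact: piecewise_affine_layer.
Qed.
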